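(* Let $X$ and $Y$ be real Banach spaces such that $X$ is uniformly convex and the pair $(\mathcal F(X),Y)$ has the Bishop-Phelps-Bollob\'as property for compact operators. Then the pair $(X,Y)$ has the local directional Bishop-Phelps-Bollob\'as property for Lipschitz compact maps. More precisely: for every $\varepsilon>0$ there exists $\eta>0$ such that for any function $\rho\colon\widetilde X\to(0,\infty)$, whenever $f\in\mathrm{Lip}_{0\mathcal K}(X,Y)$ with $\|f\|=1$ and $(x,y)\in\widetilde X$ satisfy $\frac{\|f(x)-f(y)\|}{\|x-y\|}>1-\eta$, there exist $g\in\mathrm{Lip}_{0\mathcal K}(X,Y)$ with $\|g\|=1$, $z\in S_Y$, $u\in S_X$ and $\bar x\in X$ such that $g$ attains its norm locally directionally at the point $\bar x$ in the direction $u$ toward $z$, $\|g-f\|<\varepsilon$, $\bigl\|u-\frac{x-y}{\|x-y\|}\bigr\|<\varepsilon$ and $\operatorname{dist}(\bar x,[x,y])<\varepsilon\rho(x,y)$.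
   Context: All spaces are real Banach spaces; $S_X$ is the unit sphere, $\widetilde X=\{(x,y)\in X^2: x\neq y\}$, $[x,y]$ the segment joining $x$ and $y$. $\mathrm{Lip}_0(X,Y)$ is the Banach space of Lipschitz $f\colon X\to Y$ with $f(0)=0$ and norm $\|f\|=\sup_{(x,y)\in\widetilde X}\|f(x)-f(y)\|/\|x-y\|$; $\mathrm{Lip}_{0\mathcal K}(X,Y)$ is the subspace of those $f$ whose set of slopes $\{\frac{f(x)-f(y)}{\|x-y\|}:(x,y)\in\widetilde X\}$ is relatively compact. $f$ attains its norm locally directionally at $\bar x\in X$ in the direction $u\in S_X$ toward $z\in Y$ if there is a sequence $(x_n,y_n)\in\widetilde X$ with $\frac{f(x_n)-f(y_n)}{\|x_n-y_n\|}\to z$, $\|z\|=\|f\|$, $\frac{x_n-y_n}{\|x_n-y_n\|}\to u$, and $x_n,y_n\to\bar x$. The Lipschitz-free space $\mathcal F(X)$ is the closed linear span of $\{\delta_x:x\in X\}$ in $\mathrm{Lip}_0(X,\mathbb R)^*$, where $\delta_x(f)=f(x)$. A pair of Banach spaces $(Z,Y)$ has the Bishop-Phelps-Bollob\'as property (BPBp) for compact operators if for every $\varepsilon>0$ there is $\eta>0$ such that whenever $T$ is a compact linear operator $Z\to Y$ with $\|T\|=1$ and $w\in S_Z$ satisfies $\|Tw\|>1-\eta$, there exist a compact linear $S\colon Z\to Y$ with $\|S\|=1$ and $v\in S_Z$ with $\|Sv\|=1$, $\|S-T\|<\varepsilon$, $\|v-w\|<\varepsilon$. The pair $(X,Y)$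 has the local directional BPBp (LDBPBp) for Lipschitz compact maps if for every $\varepsilon>0$ there is $\eta>0$ such that whenever $f\in\mathrm{Lip}_{0\mathcal K}(X,Y)$, $\|f\|=1$, and $(x,y)\in\widetilde X$ satisfy $\frac{\|f(x)-f(y)\|}{\|x-y\|}>1-\eta$, there exist $g\in\mathrm{Lip}_{0\mathcal K}(X,Y)$ with $\|g\|=1$, $z\in S_Y$, $u\in S_X$, $\bar x\in X$ such that $g$ attains its norm locally directionally at $\bar x$ in the direction $u$ toward $z$, $\|g-f\|<\varepsilon$, $\|u-\frac{x-y}{\|x-y\|}\|<\varepsilon$ and $\operatorname{dist}(\bar x,[x,y])<\varepsilon$. *)

(* Defs.v *)
From HB Require Import structures.
From mathcomp Require Import all_boot all_order all_algebra.
From mathcomp Require Import all_classical all_reals all_analysis.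
Set Implicit Arguments. Unset Strict Implicit. Unset Printing Implicit Defensive.
Import Order.TTheory GRing.Theory Num.Theory.
Import numFieldNormedType.Exports.
Local Open Scope classical_set_scope.
Local Open Scope ring_scope.

Section Defs.
Variable R : realType.

Definition uniformly_convex (X : normedModType R) : Prop :=
  forall e : R, 0 < e -> exists d : R, 0 < d /\
    forall x y : X, `|x| <= 1 -> `|y| <= 1 -> e <= `|x - y| ->
      `|(2 : R)^-1 *: (x + y)| <= 1 - d.

Definition lipschitz (X Y : normedModType R) (f : X -> Y) : Prop :=
  exists k : R, forall x y : X, `|f x - f y| <= k * `|x - y|.

Definition slopes (X Y : normedModType R) (f : X -> Y) : set Y :=
  [set s | exists x y : X, x <> y /\ s = (`|x - y|)^-1 *: (f x - f y)].

Definition lipnorm (X Y : normedModType R) (f : X -> Y) : R :=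
  sup [set r | exists x y : X, x <> y /\ r = `|f x - f y| / `|x - y|].

Definition Lip0 (X Y : normedModType R) (f : X -> Y) : Prop :=
  f 0 = 0 /\ lipschitz f.

Definition Lip0K (X Y : normedModType R) (f : X -> Y) : Prop :=
  Lip0 f /\ compact (closure (slopes f)).

(* Elements of the dual of Lip_0(X,R) are represented by functions
   (X -> R) -> R, only their values on Lip_0(X,R) are relevant. *)
Definition dual_bounded (X : normedModType R) (phi : (X -> R) -> R) : Prop :=
  exists k : R, forall f : X -> R^o, Lip0 f -> lipnorm f <= 1 -> `|phi f| <= k.

Definition dnorm (X : normedModType R) (phi : (X -> R) -> R) : R :=
  sup [set r | exists f : X -> R^o, Lip0 f /\ lipnorm f <= 1 /\ r = `|phi f|].

Definition delta (X : normedModType R) (x : X) : (X -> R) -> R := fun f => f x.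

Definition delta_span (X : normedModType R) : set ((X -> R) -> R) :=
  [set psi | exists (n : nat) (a : 'I_n -> R) (p : 'I_n -> X),
     psi = fun f => \sum_(i < n) a i * delta (p i) f].

Definition Free (X : normedModType R) : set ((X -> R) -> R) :=
  [set phi | dual_bounded phi /\
     forall e : R, 0 < e -> exists psi, delta_span (X:=X) psi /\
       dnorm (fun f => phi f - psi f) < e].

Definition free_operator (X Y : normedModType R) (T : ((X -> R) -> R) -> Y) : Prop :=
  (forall (a b : R) phi psi, Free (X:=X) phi -> Free (X:=X) psi ->
     T (fun f => a * phi f + b * psi f) = a *: T phi + b *: T psi) /\
  (exists k : R, forall phi, Free (X:=X) phi -> `|T phi| <= k * dnorm phi).

Definition free_opnorm (X Y : normedModType R) (T : ((X -> R) -> R) -> Y) : R :=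
  sup [set r | exists phi, Free (X:=X) phi /\ dnorm phi <= 1 /\ r = `|T phi|].

Definition free_compact_operator (X Y : normedModType R)
    (T : ((X -> R) -> R) -> Y) : Prop :=
  free_operator T /\
  compact (closure (T @` [set phi | Free (X:=X) phi /\ dnorm phi <= 1])).

Definition BPBp_compact_free (X Y : normedModType R) : Prop :=
  forall e : R, 0 < e -> exists eta : R, 0 < eta /\
    forall (T : ((X -> R) -> R) -> Y) (w : (X -> R) -> R),
      free_compact_operator T -> free_opnorm T = 1 ->
      Free (X:=X) w -> dnorm w = 1 -> `|T w| > 1 - eta ->
      exists (S : ((X -> R) -> R) -> Y) (v : (X -> R) -> R),
        free_compact_operator S /\ free_opnorm S = 1 /\
        Free (X:=X) v /\ dnorm v = 1 /\ `|S v| = 1 /\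
        free_opnorm (fun phi => S phi - T phi) < e /\
        dnorm (fun f => v f - w f) < e.

Definition lda_attains (X Y : normedModType R) (g : X -> Y) (xb u : X) (z : Y)
  : Prop :=
  `|z| = lipnorm g /\
  exists xs ys : nat -> X, (forall n, xs n <> ys n) /\
    ((fun n => (`|xs n - ys n|)^-1 *: (g (xs n) - g (ys n))) @ \oo --> z) /\
    ((fun n => (`|xs n - ys n|)^-1 *: (xs n - ys n)) @ \oo --> u) /\
    (xs @ \oo --> xb) /\ (ys @ \oo --> xb).

Definition dist_seg (X : normedModType R) (xb x y : X) : R :=
  inf [set r | exists t : R, 0 <= t <= 1 /\ r = `|xb - ((1 - t) *: x + t *: y)|].

End Defs.

(* Main.v *)
(* Perturb f by a rapidly converging series of rank-one Lipschitz maps.  If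
   the slope of g_n at a pair (p_n,q_n) has norm almost |g_n|, let
   g_{n+1} = g_n + c_n F_n z_n, where z_n is the normalized slope and F_n
   is a 1-Lipschitz function of slope 1 at (p_n,q_n).  Then
   |g_{n+1}| is almost |g_n| + c_n, so every pair almost norming
   g_{n+1} almost norms F_n too.  The function F_n is the mean of a tent
   function, which forces such a pair to lie near p_n, and of a Busemann
   function, which by uniform convexity forces its direction to be close to
   that of p_n - q_n.  Bisection makes the pairs as short as desired without
   changing their direction, so that points and directions converge; the
   slopes of the limit map at these pairs have a cluster point by
   compactness. *)
Require Import Defs.
From HB Require Import structures.
From mathcomp Require Import all_boot all_order all_algebra.
From mathcomp Require Import all_classical all_reals all_analysis.
From mathcomp Require Import ring lra.
Import Order.TTheory GRing.Theory Num.Theory.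
Import numFieldNormedType.Exports.
Local Open Scope classical_set_scope.
Local Open Scope ring_scope.

(** * The Lipschitz norm as a supremum of slopes *)

Lemma lipnorm_ge {R : realType} {X Y : normedModType R} {g : X -> Y} (x y : X) :
  Defs.lipschitz g -> `|g x - g y| <= lipnorm g * `|x - y|.
Proof.
move=> [k gk]; have [->|xy] := eqVneq x y; first by rewrite !subrr !normr0 mulr0.
have xy0 : 0 < `|x - y| by rewrite normr_gt0 subr_eq0.
rewrite -ler_pdivrMr//; apply: ub_le_sup; last by exists x, y; split => //; exact/eqP.
exists k => _ [s [t [/eqP st ->]]].
by rewrite ler_pdivrMr ?gk// normr_gt0 subr_eq0.
Qed.

(** The pair [x <> y] makes the set of quotients nonempty; on a trivial space [sup] has the default
    value 0, which a negative [k] would not bound. *)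
Lemma lipnorm_le {R : realType} {X Y : normedModType R} {g : X -> Y} {k : R} (x y : X) :
  x <> y -> (forall s t, `|g s - g t| <= k * `|s - t|) -> lipnorm g <= k.
Proof.
move=> xy gk; apply: ge_sup; first by exists (`|g x - g y| / `|x - y|), x, y.
move=> _ [s [t [/eqP st ->]]].
by rewrite ler_pdivrMr ?gk// normr_gt0 subr_eq0.
Qed.

Lemma lipnorm_adherent {R : realType} {X Y : normedModType R} {g : X -> Y} {e : R} (x y : X) :
  x <> y -> Defs.lipschitz g -> 0 < e ->
  exists p q : X, p <> q /\ (lipnorm g - e) * `|p - q| < `|g p - g q|.
Proof.
move=> xy [k gk] e0.
have [|_ [p [q [pq ->]]] h] := @sup_adherent R
    [set r | exists p q : X, p <> q /\ r = `|g p - g q| / `|p - q|] e e0.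
  split; first by exists (`|g x - g y| / `|x - y|), x, y.
  exists k => _ [s [t [/eqP st ->]]].
  by rewrite ler_pdivrMr ?gk// normr_gt0 subr_eq0.
exists p, q; split => //.
by rewrite -ltr_pdivlMr// normr_gt0 subr_eq0; exact/eqP.
Qed.

(** * Shortening a pair by bisection *)

(** By the triangle inequality one half of a segment carries at least half of the increment of [g].
    Both halves are parallel to the whole, so the direction survives every halving. *)
Lemma bisect {R : realType} {X Y : normedModType R} (g : X -> Y) (n : nat) (p q : X) :
  exists p' q' : X, p' - q' = 2 ^- n *: (p - q) /\
    `|g p - g q| <= 2 ^+ n * `|g p' - g q'| /\
    exists2 t : R, 0 <= t <= 1 & p' = (1 - t) *: p + t *: q.
Proof.
have sc (a b c d : R) (v w : X) : a = c -> b = d -> a *: v + b *: w = c *: v + d *: w.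
  by move=> -> ->.
elim: n p q => [|n IH] p q.
  exists p, q; rewrite expr0 invr1 mul1r scale1r; split=> //; split=> //.
  by exists 0; rewrite ?lexx ?ler01// subr0 scale1r scale0r addr0.
pose m := 2^-1 *: p + 2^-1 *: q.
have h2 : p = 2^-1 *: p + 2^-1 *: p by rewrite -scalerDl -[LHS]scale1r; congr (_ *: _); lra.
have h3 : q = 2^-1 *: q + 2^-1 *: q by rewrite -scalerDl -[LHS]scale1r; congr (_ *: _); lra.
have pm : p - m = 2^-1 *: (p - q).
  by rewrite [X in X - m]h2 scalerBr /m opprD addrACA subrr add0r.
have mq : m - q = 2^-1 *: (p - q).
  by rewrite [X in m - X]h3 scalerBr /m opprD addrACA subrr addr0.
have e2 : 2 ^- n.+1 = 2 ^- n * 2^-1 :> R by rewrite exprSr invfM mulrC.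
have tri : `|g p - g q| <= `|g p - g m| + `|g m - g q| by exact: ler_distD.
have [le1|le1] := leP `|g m - g q| `|g p - g m|.
- have [p' [q' [d [le2 [t t01 pE]]]]] := IH p m.
  exists p', q'; split.
    by rewrite d pm scalerA e2.
  split; first by rewrite exprS -mulrA; move: le1 le2 tri; lra.
  exists (t / 2); first by lra.
  by rewrite pE /m scalerDr addrA !scalerA -scalerDl; apply: sc; lra.
- have [p' [q' [d [le2 [t t01 pE]]]]] := IH m q.
  exists p', q'; split.
    by rewrite d mq scalerA e2.
  split; first by rewrite exprS -mulrA; move: le1 le2 tri; lra.
  exists ((1 + t) / 2); first by lra.
  by rewrite pE /m scalerDr -addrA !scalerA -scalerDl; apply: sc; lra.
Qed.

Lemma exists_invexp2_lt {R : realType} (r : R) : 0 < r -> exists n : nat, 2 ^- n < r.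
Proof.
move=> r0; have : (fun n => (2^-1 : R) ^+ n) @ \oo --> (0 : R).
  by apply: cvg_expr; rewrite ger0_norm; lra.
move/cvgrPdist_lt => /(_ _ r0)[n _ /(_ n)] /=; rewrite leqnn => /(_ isT).
rewrite sub0r normrN ger0_norm ?exprn_ge0 ?invr_ge0// => h.
by exists n; rewrite -exprVn.
Qed.

(** The clause over [c] keeps the slope norm from dropping, in the form in which lower bounds such
    as [lipnorm g - eta] are carried along. *)
Lemma short_pair {R : realType} {X Y : normedModType R} (g : X -> Y) (p q : X) (r : R) :
  p <> q -> 0 < r ->
  exists p' q' : X, p' <> q' /\ `|p' - q'| < r /\ `|p' - q'| <= `|p - q| /\
    `|p' - q'|^-1 *: (p' - q') = `|p - q|^-1 *: (p - q) /\
    (forall c, c * `|p - q| < `|g p - g q| -> c * `|p' - q'| < `|g p' - g q'|) /\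
    exists2 t : R, 0 <= t <= 1 & p' = (1 - t) *: p + t *: q.
Proof.
move=> /eqP pq r0; have pq0 : 0 < `|p - q| by rewrite normr_gt0 subr_eq0.
have [n nr] := exists_invexp2_lt (r / `|p - q|) (divr_gt0 r0 pq0).
have [p' [q' [d [le2 pt]]]] := bisect g n p q.
have e0 : 0 < 2 ^- n :> R by rewrite invr_gt0 exprn_gt0.
have dn : `|p' - q'| = 2 ^- n * `|p - q| by rewrite d normrZ ger0_norm// ltW.
exists p', q'; split.
  by apply/eqP; rewrite -subr_eq0 -normr_gt0 dn mulr_gt0.
split; first by rewrite dn -ltr_pdivlMr.
split; first by rewrite dn ger_pMl// invf_le1 ?exprn_gt0// exprn_ege1// ler1n.
split.
  by rewrite dn d scalerA invfM mulrAC mulVf ?mul1r// gt_eqF.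
split => // c cl; rewrite dn mulrCA ltr_pdivrMl ?exprn_gt0//.
exact: lt_le_trans cl le2.
Qed.

(** * Busemann functions and the exposing function *)

(* The Busemann function of the ray [t |-> - t *: u]; it replaces a
   Hahn-Banach functional norming [u]. *)
Definition busemann {R : realType} {X : normedModType R} (u t : X) : R :=
  inf [set r | exists2 L : R, 0 <= L & r = `|t + L *: u| - L].

Lemma busemann_le {R : realType} {X : normedModType R} (u t : X) (L : R) :
  `|u| = 1 -> 0 <= L -> busemann u t <= `|t + L *: u| - L.
Proof.
move=> u1 L0; apply: ge_inf; last by exists L.
(* The triangle inequality keeps all competitors above minus the norm of [t], so the infimum is a
   genuine one. *)
exists (- `|t|) => _ [M M0 ->].
have := ler_normB (t + M *: u) t.
by rewrite addrAC subrr add0r normrZ u1 mulr1 ger0_norm//; lra.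
Qed.

Lemma le_busemann {R : realType} {X : normedModType R} (u t : X) (c : R) :
  (forall L, 0 <= L -> c <= `|t + L *: u| - L) -> c <= busemann u t.
Proof.
move=> h; apply: lb_le_inf; first by exists (`|t + 0 *: u| - 0), 0.
by move=> _ [L L0 ->]; exact: h.
Qed.

(** If [L] competes for [s] and [M] for [t], then [L + M] competes for [s + t], and the triangle
    inequality bounds its value by the sum of the two. *)
Lemma busemann_subadd {R : realType} {X : normedModType R} (u s t : X) :
  `|u| = 1 -> busemann u (s + t) <= busemann u s + busemann u t.
Proof.
move=> u1; rewrite -lerBlDr; apply: le_busemann => L L0.
rewrite lerBlDl -lerBlDr; apply: le_busemann => M M0.
have := busemann_le u (s + t) (L + M) u1 (addr_ge0 L0 M0).
have := ler_normD (s + L *: u) (t + M *: u).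
by rewrite addrACA -scalerDl; lra.
Qed.

Lemma busemann_sub {R : realType} {X : normedModType R} (u s t : X) :
  `|u| = 1 -> busemann u s - busemann u t <= busemann u (s - t).
Proof. by move=> u1; rewrite lerBlDr -{1}(subrK t s) busemann_subadd. Qed.

Lemma busemann_lip {R : realType} {X : normedModType R} (u s t : X) :
  `|u| = 1 -> `|busemann u s - busemann u t| <= `|s - t|.
Proof.
move=> u1; have h a b : busemann u a - busemann u b <= `|a - b|.
  apply: le_trans (busemann_sub u a b u1) _.
  by have := busemann_le u (a - b) 0 u1 (lexx _); rewrite scale0r addr0 subr0.
by rewrite ler_norml h andbT; have := h t s; rewrite distrC; lra.
Qed.

Lemma busemann_ray {R : realType} {X : normedModType R} (u t : X) (r : R) :
  `|u| = 1 -> 0 <= r -> busemann u (t + r *: u) - busemann u t = r.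
Proof.
move=> u1 r0; apply/eqP; rewrite eq_le; apply/andP; split.
  apply: le_trans (ler_norm _) _; apply: le_trans (busemann_lip _ _ _ u1) _.
  by rewrite addrAC subrr add0r normrZ u1 mulr1 ger0_norm.
(* Lower bound: [t] is [t + r *: u] plus [- r *: u], and the competitor [L = r] shows that the
   Busemann function is at most [- r] at [- r *: u]. *)
suff : busemann u t <= busemann u (t + r *: u) - r by lra.
have -> : busemann u t = busemann u ((t + r *: u) + - r *: u).
  by rewrite scaleNr addrK.
apply: le_trans (busemann_subadd _ _ _ u1) _; rewrite lerD2l.
have := busemann_le u (- r *: u) r u1 r0.
by rewrite -scalerDl addNr scale0r normr0 sub0r.
Qed.

(** [F] is the mean of two 1-Lipschitz functions of slope 1 at [(p, q)]. Where its slope exceeds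
    [1 - d], each of the two has slope above [1 - 2 * d], which is nonnegative. For the tent this
    puts [s] into its support; for the Busemann function it makes the sum of the two unit directions
    long, the input for uniform convexity. *)
Lemma exposing_function {R : realType} {X : normedModType R} (p q : X) :
  p <> q -> exists F : X -> R,
    [/\ forall s t, `|F s - F t| <= `|s - t|,
        F p - F q = `|p - q| &
        forall (d : R) (s t : X), 0 < d <= 1 / 2 ->
          (1 - d) * `|s - t| < F s - F t ->
          `|s - p| <= `|p - q| /\
          (1 - d) * 2 < `| `|s - t|^-1 *: (s - t) + `|p - q|^-1 *: (p - q)|].
Proof.
move=> /eqP pq; have r0 : 0 < `|p - q| by rewrite normr_gt0 subr_eq0.
set r := `|p - q| in r0 *; set u := r^-1 *: (p - q).
have u1 : `|u| = 1 by rewrite normrZ normfV ger0_norm ?ltW// -/r mulVf// gt_eqF.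
(* The tent of height and radius [r] around [p]; it vanishes at [q]. *)
pose phi (t : X) : R := Num.max 0 (r - `|t - p|).
have phi_sub s t : phi s - phi t <= `|s - t|.
  rewrite /phi; have := ler_distD s t p; rewrite (distrC t s).
  have := normr_ge0 (s - t).
  by rewrite /Num.max; case: ltP => ?; case: ltP => ?; lra.
exists (fun t => (phi t + busemann u t) / 2); split.
- move=> s t; have := busemann_lip u s t u1; rewrite !ler_norml.
  have := phi_sub s t; have := phi_sub t s; rewrite (distrC t s); lra.
- have -> : p = q + r *: u by rewrite scalerA divff ?gt_eqF// scale1r subrKC.
  have phiq : phi q = 0.
    by rewrite /phi distrC -/r subrr maxxx.
  have phip : phi (q + r *: u) = r.
    rewrite scalerA divff ?gt_eqF// scale1r subrKC /phi subrr normr0 subr0.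
    by apply/max_idPr/ltW.
  by rewrite phip phiq; have := busemann_ray u q r u1 (ltW r0); lra.
- move=> d s t d0 h; have := phi_sub s t => hphi.
  have /andP[_ hb] : - `|s - t| <= busemann u s - busemann u t <= `|s - t|.
    by rewrite -ler_norml busemann_lip.
  have n0 := normr_ge0 (s - t).
  have st0 : 0 < `|s - t|.
    rewrite lt_def n0 andbT; apply/eqP => st0.
    by move: h hphi hb; rewrite st0; lra.
  have dn : d * `|s - t| <= 1 / 2 * `|s - t| by rewrite ler_wpM2r//; lra.
  split.
    have : 0 < phi s.
      have : 0 <= phi t by rewrite /phi le_max lexx.
      by move: h hphi hb dn; lra.
    by rewrite /phi lt_max ltxx /=; lra.
  (* Taking [L] equal to the length of [s - t] lets this length factor out, leaving the norm of a
     sum of two unit vectors. *)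
  have := busemann_le u (s - t) `|s - t| u1 n0.
  have := busemann_sub u s t u1.
  have -> : `|(s - t) + `|s - t| *: u| = `|s - t| * `| `|s - t|^-1 *: (s - t) + u|.
    have e : `|s - t| *: (`|s - t|^-1 *: (s - t)) = s - t.
      by rewrite scalerA divff ?gt_eqF// scale1r.
    by rewrite -[X in _ = X * _]normr_id -normrZ scalerDr e.
  by rewrite -(ltr_pM2l st0) => h1 h2; move: h hphi; lra.
Qed.

(** * One perturbation step *)

(** The slopes of [F] lie in [[-1, 1]], so the new slopes lie in the continuous image of a compact
    product. Subtracting [F 0] keeps the value 0 at the origin. *)
Lemma Lip0K_perturb {R : realType} {X Y : normedModType R} (g : X -> Y)
    (F : X -> R) (c : R) (z : Y) :
  Lip0K g -> (forall s t, `|F s - F t| <= `|s - t|) ->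
  Lip0K (fun t => g t + (c * (F t - F 0)) *: z).
Proof.
move=> [[g0 [k gk]] cg] FL.
have dE s t : (g s + (c * (F s - F 0)) *: z) - (g t + (c * (F t - F 0)) *: z) =
    (g s - g t) + (c * (F s - F t)) *: z.
  rewrite opprD addrACA -scalerBl; congr (_ + _ *: _); ring.
split; first split.
- by rewrite g0 subrr mulr0 scale0r addr0.
- exists (k + `|c| * `|z|) => s t; rewrite dE.
  apply: le_trans (ler_normD _ _) _; rewrite mulrDl lerD//.
  by rewrite normrZ normrM mulrAC ler_wpM2l// mulr_ge0.
pose h (w : Y * R) : Y := w.1 + (c * w.2) *: z.
have hc : continuous h.
  move=> w; apply: cvgD; first exact: cvg_fst.
  apply: cvgZr_tmp; apply: cvgM; [exact: cvg_cst|exact: cvg_snd].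
have ch : compact (h @` (closure (slopes g) `*` `[-1, 1]%classic)).
  apply: continuous_compact; first exact: continuous_subspaceT.
  by apply: compact_setX => //; exact: segment_compact.
apply: (subclosed_compact _ ch); first exact: closed_closure.
rewrite closureE; apply: smallest_sub.
  exact: compact_closed (@norm_hausdorff _ _) ch.
move=> _ [s [t [/eqP st ->]]].
have st0 : 0 < `|s - t| by rewrite normr_gt0 subr_eq0.
exists (`|s - t|^-1 *: (g s - g t), (F s - F t) / `|s - t|) => /=.
  split=> /=; first by apply: subset_closure; exists s, t; split=> //; exact/eqP.
  by rewrite in_itv/= -ler_norml normf_div normr_id ler_pdivrMr// mul1r.
by rewrite /h/= dE [in RHS]scalerDr scalerA; congr (_ + _ *: _); ring.
Qed.

(** The gain at [(p, q)] lifts [lipnorm g'] above [lipnorm g - eta + c], while [g] contributes at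
    most [lipnorm g] to a slope of [g']. So a pair norming [g'] up to [eta'] has an [F]-slope of
    modulus above [1 - (eta + eta') / c], hence above [1 - d]. *)
Lemma step {R : realType} {X Y : normedModType R} (a d c eta eta' : R)
    (g : X -> Y) (p q : X) :
  0 < d <= 1 / 2 ->
  (forall u v : X, `|u| = 1 -> `|v| = 1 -> (1 - d) * 2 < `|u + v| -> `|u - v| < a) ->
  0 < c -> 0 < eta <= 1 -> 0 < eta' -> eta + eta' <= c * d ->
  Lip0K g -> 1 <= lipnorm g -> p <> q ->
  (lipnorm g - eta) * `|p - q| < `|g p - g q| ->
  exists (g' : X -> Y) (p' q' : X),
    [/\ Lip0K g', lipnorm g <= lipnorm g', p' <> q' &
        (lipnorm g' - eta') * `|p' - q'| < `|g' p' - g' q'|] /\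
    [/\ `|p' - p| <= `|p - q|, `|p' - q'| <= `|p - q| / 2,
        `| `|p' - q'|^-1 *: (p' - q') - `|p - q|^-1 *: (p - q)| < a &
        forall s t, `|(g' s - g s) - (g' t - g t)| <= c * `|s - t|].
Proof.
move=> d01 uc c0 /andP[eta0 eta1] eta'0 etac gK g1 pq gpq.
have [F [FL Fpq Fexp]] := exposing_function p q pq.
have r0 : 0 < `|p - q| by rewrite normr_gt0 subr_eq0; exact/eqP.
have D0 : 0 < `|g p - g q|.
  by apply: le_lt_trans gpq; rewrite mulr_ge0//; lra.
pose z := `|g p - g q|^-1 *: (g p - g q).
have z1 : `|z| = 1 by rewrite normrZ normfV normr_id mulVf// gt_eqF.
pose g' t := g t + (c * (F t - F 0)) *: z.
have g'K : Lip0K g' by exact: Lip0K_perturb.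
have g'L : Defs.lipschitz g' by case: g'K => -[].
have gL : Defs.lipschitz g by case: gK => -[].
have dE s t : g' s - g' t = (g s - g t) + (c * (F s - F t)) *: z.
  rewrite /g' opprD addrACA -scalerBl; congr (_ + _ *: _); ring.
have g'lo : lipnorm g - eta + c < lipnorm g'.
  (* [z] is the direction of [g p - g q], so the two increments add up without cancellation. *)
  have : `|g' p - g' q| = `|g p - g q| + c * `|p - q|.
    rewrite dE Fpq /z scalerA -[X in X + _ *: _]scale1r -scalerDl normrZ ger0_norm.
      by rewrite mulrDl mul1r divfK// gt_eqF.
    by rewrite addr_ge0// divr_ge0// mulr_ge0// ltW.
  have := lipnorm_ge p q g'L => h1 h2.
  by rewrite -(ltr_pM2r r0); move: h1 h2 gpq; lra.
have [p1 [q1 [pq1 l1]]] := lipnorm_adherent p q pq g'L eta'0.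
have [p2 [q2 [pq2 [s2 [_ [_ [/(_ _ l1) l2 _]]]]]]] :=
  short_pair g' p1 q1 (`|p - q| / 2) pq1 (divr_gt0 r0 (ltr0Sn R 1)).
have n0 : 0 < `|p2 - q2| by rewrite normr_gt0 subr_eq0; exact/eqP.
have F2 : (1 - d) * `|p2 - q2| < `|F p2 - F q2|.
  have h1 : `|g' p2 - g' q2| <= lipnorm g * `|p2 - q2| + c * `|F p2 - F q2|.
    rewrite dE; apply: le_trans (ler_normD _ _) _; apply: lerD.
      exact: lipnorm_ge.
    by rewrite normrZ z1 mulr1 normrM ger0_norm// ltW.
  have h2 : (lipnorm g - eta + c - eta') * `|p2 - q2| <=
            (lipnorm g' - eta') * `|p2 - q2|.
    by apply: ler_wpM2r => //; move: g'lo; lra.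
  have h3 : (c * (1 - d)) * `|p2 - q2| <= (c - eta - eta') * `|p2 - q2|.
    by apply: ler_wpM2r => //; move: etac; lra.
  by rewrite -(ltr_pM2l c0); move: h1 h2 h3 l2; lra.
(* So far only the modulus of the [F]-slope is controlled. Swapping the points makes it positive and
   leaves the slope norm of [g'] unchanged. *)
have [p' [q' [pq' [s' [l' F']]]]] : exists p' q' : X, p' <> q' /\
    `|p' - q'| < `|p - q| / 2 /\
    (lipnorm g' - eta') * `|p' - q'| < `|g' p' - g' q'| /\
    (1 - d) * `|p' - q'| < F p' - F q'.
  have [F0|F0] := leP 0 (F p2 - F q2).
    by exists p2, q2; do !split => //; rewrite -(ger0_norm F0).
  exists q2, p2; split; first exact: nesym.
  by rewrite distrC (distrC (g' _)) -(opprB (F p2)) -(ltr0_norm F0).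
have [near_p near_u] := Fexp d p' q' d01 F'.
have n0' : 0 < `|p' - q'| by rewrite normr_gt0 subr_eq0; exact/eqP.
exists g', p', q'; split; split => //.
- by move: g'lo etac d01; nra.
- exact: ltW.
- by apply: uc => //; rewrite normrZ normfV normr_id mulVf// gt_eqF.
- move=> s t.
  have -> : g' s - g s - (g' t - g t) = (c * (F s - F t)) *: z.
    have dg w : g' w - g w = (c * (F w - F 0)) *: z by rewrite /g' addrAC subrr add0r.
    by rewrite !dg -scalerBl; congr (_ *: _); ring.
  by rewrite normrZ z1 mulr1 normrM (ger0_norm (ltW c0)) ler_pM2l.
Qed.

(** * Compactness and geometric convergence *)

(** An ultrafilter on the closure is pushed into a compact [K] by choosing nearby points. A cluster
    point of the image is the centre of a small ball belonging to the ultrafilter, which is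
    therefore Cauchy and converges by completeness. *)
Lemma compact_closure_approx {R : realType} {Y : completeNormedModType R} (A : set Y) :
  (forall e : R, 0 < e -> exists2 K : set Y, compact K &
     forall a, A a -> exists2 k, K k & `|a - k| <= e) ->
  compact (closure A).
Proof.
move=> Aapp; rewrite compact_ultra => F FU FA; have FP : ProperFilter F := @ultra_proper _ _ FU.
suff /cauchy_cvgP Fc : cauchy F.
  have [l Fl] := (cvg_ex F).1 Fc.
  exists l; split => //; apply: closed_closure => B /Fl FB.
  exact: filter_ex (filterI FA FB).
apply/cauchy_exP => e e0.
have e4 : 0 < e / 4 by lra.
have [K cK AK] := Aapp _ e4.
have /choice[pi piP] : forall b : Y, exists k, closure A b -> K k /\ `|b - k| < e / 2.
  move=> b; have [Ab|] := pselect (closure A b); last by exists b.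
  have [a [Aa ba]] := Ab _ (nbhsx_ballx b _ e4).
  have [k Kk ak] := AK a Aa; exists k => _; split => //.
  rewrite -ball_normE/= in ba; apply: le_lt_trans (ler_distD a _ _) _; lra.
have FK : F (pi @^-1` K) by apply: filterS FA => b /piP[].
have [c [Kc cc]] := cK (pi @ F) _ FK.
(* If the complement of the ball were in [F], the chosen points would stay farther than [e / 2] from
   [c], against clustering at [c]. *)
exists c; have [//|Fn] := in_ultra_setVsetC (ball c e) FU.
have Fe : F (pi @^-1` [set y | e / 2 < `|c - y|]).
  apply: (filterS _ (filterI FA Fn)) => b [/piP[_ h]].
  rewrite -ball_normE/= => /negP; rewrite -leNgt => h2.
  by have := ler_distD (pi b) c b; rewrite (distrC (pi b)); lra.
by have [y []] := cc _ _ Fe (nbhsx_ballx c _ e4); rewrite /= -ball_normE/=; lra.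
Qed.

Lemma cvg_geometric_bound {R : realType} {X : normedModType R} (x : nat -> X)
    (l : X) (c : R) :
  (forall n, `|l - x n| <= c * 2 ^- n) -> x @ \oo --> l.
Proof.
move=> h; apply/cvgrPdist_le => e e0.
have c0 : 0 <= c.
  by have := le_trans (normr_ge0 _) (h 0%N); rewrite expr0 invr1 mulr1.
have [n hn] := exists_invexp2_lt (e / (c + 1)) (divr_gt0 e0 (ltr_wpDl c0 ltr01)).
exists n => // m /= nm; apply: le_trans (h m) _.
rewrite ltr_pdivlMr in hn; last by rewrite ltr_wpDl.
have mn : 2 ^- m <= 2 ^- n :> R.
  by rewrite lef_pV2 ?posrE ?exprn_gt0// ler_weXn2l// ler1n.
have p0 : 0 <= 2 ^- m :> R by rewrite invr_ge0 exprn_ge0.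
by nra.
Qed.

Lemma geometric_cvg {R : realType} {X : completeNormedModType R} (x : nat -> X) (c : R) :
  (forall n, `|x n.+1 - x n| <= c * 2 ^- n) ->
  exists l, forall n, `|l - x n| <= 2 * c * 2 ^- n.
Proof.
move=> h.
have c0 : 0 <= c.
  by have := le_trans (normr_ge0 _) (h 0%N); rewrite expr0 invr1 mulr1.
have p0 n : 0 < 2 ^- n :> R by rewrite invr_gt0 exprn_gt0.
(* The bound keeps the exact remainder of the geometric series, so that the induction on [k]
   closes. *)
have tail n k : `|x (n + k)%N - x n| <= 2 * c * 2 ^- n - 2 * c * 2 ^- (n + k).
  elim: k => [|k IH]; first by rewrite addn0 !subrr normr0.
  have := h (n + k)%N; rewrite addnS.
  have := ler_distD (x (n + k)%N) (x (n + k).+1) (x n).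
  by rewrite (exprS 2 (n + k)%N) invfM; move: IH; lra.
have tail' n m : (n <= m)%N -> `|x m - x n| <= 2 * c * 2 ^- n.
  move=> nm; have := tail n (m - n)%N; rewrite subnKC// => h1.
  by apply: le_trans h1 _; rewrite gerBl; apply: mulr_ge0; [exact: mulr_ge0|exact: ltW].
have : cauchy (x @ \oo).
  apply/cauchy_exP => e e0.
  have [n hn] := exists_invexp2_lt (e / (2 * c + 1))
    (divr_gt0 e0 (ltr_wpDl (mulr_ge0 (ler0n R 2) c0) ltr01)).
  rewrite ltr_pdivlMr in hn; last by rewrite ltr_wpDl// mulr_ge0.
  exists (x n); exists n => // m /= nm; rewrite -ball_normE/= distrC.
  by apply: le_lt_trans (tail' _ _ nm) _; have := p0 n; lra.
move/cauchy_cvgP/cvg_ex => [l xl]; exists l => n.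
apply/ler_addgt0Pr => e e0.
have [k _ /(_ (maxn n k))/= hk] := (cvgrPdist_le _ _).1 xl e e0.
have := ler_distD (x (maxn n k)) l (x n).
by have := hk (leq_maxr _ _); have := tail' n (maxn n k) (leq_maxl _ _); lra.
Qed.

Lemma invexp2_ge0_le {R : realType} (a b : R) :
  (forall n, a <= b * 2 ^- n) -> a <= 0.
Proof.
move=> h; rewrite leNgt; apply/negP => a0.
have b0 : 0 < b by have := h 0%N; rewrite expr0 invr1 mulr1; exact: lt_le_trans.
have [n] := exists_invexp2_lt _ (divr_gt0 a0 b0).
by rewrite ltr_pdivlMr// mulrC ltNge h.
Qed.

Lemma subrACA {V : zmodType} (x y z t : V) : (x - y) - (z - t) = (x - z) - (y - t).
Proof. by rewrite !opprD addrACA. Qed.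

(** A cluster point is approached within [2 ^- n] beyond every index [n]. Instead of monotonicity,
    [n <= k n] is recorded, which suffices for convergence along [k]. *)
Lemma compact_seq_subsequence {R : realType} {Y : normedModType R} (K : set Y)
    (s : nat -> Y) : compact K -> (forall n, K (s n)) ->
  exists (z : Y) (k : nat -> nat), forall n, (n <= k n)%N /\ `|z - s (k n)| <= 2 ^- n.
Proof.
move=> cK Ks; have [z [_ zc]] : K `&` cluster (s @ \oo) !=set0.
  by apply: cK; exists 0%N => // n _; exact: Ks.
suff /choice[k hk] : forall n, exists m, (n <= m)%N /\ `|z - s m| <= 2 ^- n by exists z, k.
move=> n; have e0 : 0 < 2 ^- n :> R by rewrite invr_gt0 exprn_gt0.
have sn : (s @ \oo) [set s m | m in [set m | (n <= m)%N]].
  by exists n => // m /= nm; exists m.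
have [y [[m /= nm <-]]] := zc _ _ sn (nbhsx_ballx z _ e0).
by rewrite -ball_normE/= => /ltW zm; exists m.
Qed.

Lemma normr_unitv {R : realType} {X : normedModType R} (x y : X) :
  x <> y -> `| `|x - y|^-1 *: (x - y)| = 1.
Proof.
move=> /eqP xy; rewrite normrZ normfV normr_id mulVf//.
by rewrite normr_eq0 subr_eq0.
Qed.

(** * The limit of the perturbed maps *)

Lemma lipnorm_add_le {R : realType} {X Y : normedModType R} (g h : X -> Y) (c : R)
    (x y : X) : x <> y -> Defs.lipschitz g ->
  (forall s t, `|(h s - g s) - (h t - g t)| <= c * `|s - t|) ->
  lipnorm h <= lipnorm g + c.
Proof.
move=> xy gL hg; apply: (lipnorm_le x y xy) => s t.
have -> : h s - h t = (g s - g t) + ((h s - g s) - (h t - g t)).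
  by rewrite subrACA [RHS]addrC subrK.
apply: le_trans (ler_normD _ _) _; rewrite mulrDl lerD//; exact: lipnorm_ge.
Qed.

(** Every slope of [G] is within [c * 2 ^- n] of a slope of [g n], so relative compactness passes to
    the limit by approximation. *)
Lemma Lip0K_limit {R : realType} {X : normedModType R} {Y : completeNormedModType R}
    (g : nat -> X -> Y) (G : X -> Y) (c : R) :
  (forall n, Lip0K (g n)) ->
  (forall n s t, `|(G s - g n s) - (G t - g n t)| <= c * 2 ^- n * `|s - t|) ->
  G 0 = 0 -> Lip0K G.
Proof.
move=> gK gG G0; split; first split => //.
  have [[_ [k gk]] _] := gK 0%N; exists (k + c) => s t.
  have -> : G s - G t = (g 0%N s - g 0%N t) + ((G s - g 0%N s) - (G t - g 0%N t)).
    by rewrite subrACA [RHS]addrC subrK.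
  apply: le_trans (ler_normD _ _) _; rewrite mulrDl lerD//.
  by have := gG 0%N s t; rewrite expr0 invr1 mulr1.
apply: compact_closure_approx => e e0.
have c0 : 0 < `|c| + 1 by rewrite ltr_wpDl.
have [n hn] := exists_invexp2_lt (e / (`|c| + 1)) (divr_gt0 e0 c0).
rewrite ltr_pdivlMr// in hn.
exists (closure (slopes (g n))); first by have [] := gK n.
move=> _ [s [t [st ->]]].
exists (`|s - t|^-1 *: (g n s - g n t)).
  by apply: subset_closure; exists s, t.
have st0 : 0 < `|s - t| by rewrite normr_gt0 subr_eq0; exact/eqP.
rewrite -scalerBr normrZ normfV normr_id ler_pdivrMl//.
rewrite subrACA; apply: le_trans (gG n s t) _; rewrite mulrC ler_wpM2l//.
apply: le_trans (ltW hn); rewrite mulrC ler_wpM2l ?invr_ge0 ?exprn_ge0//.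
by have := ler_norm c; lra.
Qed.

(** All increments are geometric, so points, directions and values converge. The slopes of [G] at
    the pairs [(p n, q n)] have norms tending to [lipnorm G], and compactness of the closure of the
    slopes yields [z] along a subsequence of indices. *)
Lemma limit_attains {R : realType} {X Y : completeNormedModType R}
    (g : nat -> X -> Y) (p q : nat -> X) (a c : R) :
  let u n := `|p n - q n|^-1 *: (p n - q n) in
  (forall n, Lip0K (g n)) -> (forall n, 1 <= lipnorm (g n)) ->
  (forall n, p n <> q n) ->
  (forall n, (lipnorm (g n) - c * 2 ^- n) * `|p n - q n| < `|g n (p n) - g n (q n)|) ->
  (forall n, `|p n.+1 - p n| <= `|p n - q n|) ->
  (forall n, `|p n.+1 - q n.+1| <= `|p n - q n| / 2) ->
  (forall n, `|u n.+1 - u n| <= a * 2 ^- n) ->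
  (forall n s t, `|(g n.+1 s - g n s) - (g n.+1 t - g n t)| <= c * 2 ^- n * `|s - t|) ->
  exists (G : X -> Y) (v xb : X) (z : Y),
    [/\ Lip0K G, 1 <= lipnorm G, `|v| = 1 & lda_attains G xb v z] /\
    [/\ forall s t, `|(G s - g 0%N s) - (G t - g 0%N t)| <= 2 * c * `|s - t|,
        `|v - u 0%N| <= 2 * a & `|xb - p 0%N| <= 2 * `|p 0%N - q 0%N|].
Proof.
move=> u gK g1 pq gpq pp pq2 uu gg.
have p2 n : 0 < 2 ^- n :> R by rewrite invr_gt0 exprn_gt0.
have r0 n : 0 < `|p n - q n| by rewrite normr_gt0 subr_eq0; exact/eqP.
have g0 n : g n 0 = 0 by case: (gK n) => -[].
have pq_geo n : `|p n - q n| <= `|p 0%N - q 0%N| * 2 ^- n.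
  elim: n => [|n IH]; first by rewrite expr0 invr1 mulr1.
  by have := pq2 n; rewrite exprS invfM; lra.
have [xb hxb] := geometric_cvg p _ (fun n => le_trans (pp n) (pq_geo n)).
have [v hv] := geometric_cvg u a uu.
have /choice[G hG] : forall t, exists l : Y, forall n, `|l - g n t| <= 2 * (c * `|t|) * 2 ^- n.
  move=> t; apply: geometric_cvg => n.
  by have := gg n t 0; rewrite !g0 !subr0 mulrAC.
have cvgG t : (fun n => g n t) @ \oo --> G t := cvg_geometric_bound _ _ _ (hG t).
(* The bound has to be proportional to the distance of [s] and [t], so geometric convergence is
   applied to the differences [g m s - g m t]; uniqueness of limits identifies the result. *)
have GL n s t : `|(G s - g n s) - (G t - g n t)| <= (2 * c) * 2 ^- n * `|s - t|.
  have [m|l hl] := geometric_cvg (fun m => g m s - g m t) (c * `|s - t|).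
    by rewrite subrACA mulrAC; exact: gg.
  have := cvg_unique (@norm_hausdorff _ _) (cvg_geometric_bound _ _ _ hl)
    (cvgB (cvgG s) (cvgG t)).
  rewrite subrACA => <-; apply: le_trans (hl n) _.
  by rewrite le_eqVlt; apply/orP; left; apply/eqP; ring.
have G0 : G 0 = 0.
  apply/eqP; rewrite -normr_le0; have := hG 0 0%N.
  by rewrite normr0 !mulr0 mul0r g0 subr0.
have GK : Lip0K G by exact: Lip0K_limit gK GL G0.
have gLip n : Defs.lipschitz (g n) by case: (gK n) => -[].
have GLip : Defs.lipschitz G by case: GK => -[].
have NG n : lipnorm G <= lipnorm (g n) + 2 * c * 2 ^- n.
  exact: lipnorm_add_le (pq n) (gLip n) (GL n).
have Ng n : lipnorm (g n) <= lipnorm G + 2 * c * 2 ^- n.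
  apply: lipnorm_add_le (pq n) GLip _ => s t.
  by rewrite -normrN opprB -(opprB (G t)) -(opprB (G s)) opprK addrC; exact: GL.
(* The 5 is made of 1 from the almost norming pair of [g n], 2 from comparing [lipnorm G] with
   [lipnorm (g n)], and 2 from replacing the slope of [g n] by that of [G]. *)
have slope_lo n : (lipnorm G - 5 * c * 2 ^- n) * `|p n - q n| <= `|G (p n) - G (q n)|.
  have := GL n (p n) (q n); have := ler_normB (G (p n) - G (q n)) (G (p n) - g n (p n) - (G (q n) - g n (q n))).
  have -> : G (p n) - G (q n) - (G (p n) - g n (p n) - (G (q n) - g n (q n))) = g n (p n) - g n (q n).
    by rewrite [X in _ - X]subrACA subKr.
  have : (lipnorm G - 5 * c * 2 ^- n) * `|p n - q n| <= (lipnorm (g n) - 3 * c * 2 ^- n) * `|p n - q n|.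
    by rewrite ler_wpM2r//; have := NG n; lra.
  by have := gpq n; lra.
pose s n := `|p n - q n|^-1 *: (G (p n) - G (q n)).
have s_up n : `|s n| <= lipnorm G.
  by rewrite normrZ normfV normr_id ler_pdivrMl// mulrC lipnorm_ge.
have s_lo n : lipnorm G - 5 * c * 2 ^- n <= `|s n|.
  by rewrite normrZ normfV normr_id ler_pdivlMl// mulrC.
have [z [k hk]] : exists (z : Y) (k : nat -> nat),
    forall n, (n <= k n)%N /\ `|z - s (k n)| <= 2 ^- n.
  apply: (compact_seq_subsequence (closure (slopes G))); first by case: GK.
  by move=> n; apply: subset_closure; exists (p n), (q n).
have c0 : 0 <= c.
  by have := le_trans (normr_ge0 _) (gg 0%N (p 0%N) (q 0%N)); rewrite pmulr_lge0// pmulr_lge0.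
have a0 : 0 <= a by have := le_trans (normr_ge0 _) (uu 0%N); rewrite pmulr_lge0.
have k2 n : 2 ^- k n <= 2 ^- n :> R.
  by rewrite lef_pV2 ?posrE ?exprn_gt0// ler_weXn2l ?ler1n//; case: (hk n).
have zN : `|z| = lipnorm G.
  apply/eqP; rewrite eq_le; apply/andP; split; rewrite -subr_le0.
    apply: (invexp2_ge0_le _ 1) => n; have [_ h] := hk n.
    by have := ler_normD (s (k n)) (z - s (k n)); have := s_up (k n); rewrite subrKC; lra.
  apply: (invexp2_ge0_le _ (1 + 5 * c)) => n; have [_ h] := hk n.
  have := ler_normB z (z - s (k n)); rewrite subKr.
  have := ler_wpM2l (mulr_ge0 (ler0n R 5) c0) (k2 n).
  by have := s_lo (k n); lra.
have shift (x : nat -> X) l C : (forall n, `|l - x n| <= C * 2 ^- n) -> 0 <= C -> (x \o k) @ \oo --> l.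
  move=> hx C0; apply: (cvg_geometric_bound _ _ C) => n.
  by apply: le_trans (hx (k n)) _; rewrite ler_wpM2l.
have xbp := shift p xb _ hxb (mulr_ge0 (ler0n R 2) (ltW (r0 0%N))).
exists G, v, xb, z; split; split => //.
- have N1 n : 1 <= lipnorm G + 2 * c * 2 ^- n := le_trans (g1 n) (Ng n).
  by rewrite -subr_le0; apply: (invexp2_ge0_le _ (2 * c)) => n; have := N1 n; lra.
- apply/eqP; rewrite -subr_eq0 -normr_le0; apply: (invexp2_ge0_le _ (2 * a)) => n.
  have := le_trans (ler_dist_dist v (u n)) (hv n).
  by rewrite (normr_unitv (p n) (q n) (pq n)).
- split=> //; exists (p \o k), (q \o k); split=> [n /=|]; first exact: pq.
  split; first by apply: (cvg_geometric_bound _ _ 1) => n; rewrite mul1r; case: (hk n).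
  split; first exact: shift hv (mulr_ge0 (ler0n R 2) a0).
  (* The 3 is 2 for the distance from [xb] to [p n] plus 1 for the length of the pair. *)
  split=> //; apply: (shift q xb (3 * `|p 0%N - q 0%N|)); last exact: mulr_ge0.
  by move=> n; have := ler_distD (p n) xb (q n); have := pq_geo n; have := hxb n; lra.
- by move=> s' t'; have := GL 0%N s' t'; rewrite expr0 invr1 mulr1.
- by have := hv 0%N; rewrite expr0 invr1 mulr1.
- by have := hxb 0%N; rewrite expr0 invr1 mulr1.
Qed.

(** * Rescaling, distance to a segment, uniform convexity *)

Lemma Lip0KZ {R : realType} {X Y : normedModType R} (g : X -> Y) (c : R) :
  Lip0K g -> Lip0K (fun t => c *: g t).
Proof.
move=> [[g0 [k gk]] cg]; split; first split; first by rewrite g0 scaler0.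
  exists (`|c| * k) => s t.
  by rewrite -scalerBr normrZ -mulrA ler_wpM2l.
have cc : compact ((fun y : Y => c *: y) @` closure (slopes g)).
  apply: continuous_compact => //; apply: continuous_subspaceT => y.
  by apply: cvgZl_tmp; exact: cvg_id.
apply: (subclosed_compact _ cc); first exact: closed_closure.
rewrite closureE; apply: smallest_sub.
  exact: compact_closed (@norm_hausdorff _ _) cc.
move=> _ [s [t [st ->]]]; exists (`|s - t|^-1 *: (g s - g t)).
  by apply: subset_closure; exists s, t.
by rewrite -scalerBr !scalerA mulrC.
Qed.

Lemma lipnormZ {R : realType} {X Y : normedModType R} (g : X -> Y) (c : R) (x y : X) :
  x <> y -> Defs.lipschitz g -> 0 < c ->
  lipnorm (fun t => c *: g t) = c * lipnorm g.
Proof.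
move=> xy gL c0; apply/eqP; rewrite eq_le; apply/andP; split.
  apply: (lipnorm_le x y xy) => s t.
  by rewrite -scalerBr normrZ gtr0_norm// -mulrA ler_pM2l// lipnorm_ge.
rewrite -ler_pdivlMl//; apply: (lipnorm_le x y xy) => s t.
rewrite -mulrA ler_pdivlMl// -{1}(gtr0_norm c0) -normrZ scalerBr.
apply: (@lipnorm_ge _ _ _ (fun t => c *: g t)).
case: gL => k gk; exists (c * k) => s' t'.
by rewrite -scalerBr normrZ gtr0_norm// -mulrA ler_pM2l.
Qed.

Lemma lda_attainsZ {R : realType} {X Y : normedModType R} (g : X -> Y)
    (xb u : X) (z : Y) (c : R) : Defs.lipschitz g -> 0 < c ->
  lda_attains g xb u z -> lda_attains (fun t => c *: g t) xb u (c *: z).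
Proof.
move=> gL c0 [zN [xs [ys [xy [sz [su [xsb ysb]]]]]]].
split; first by rewrite (lipnormZ g c _ _ (xy 0%N))// normrZ gtr0_norm// zN.
exists xs, ys; do !split => //.
under eq_fun do rewrite -scalerBr scalerA mulrC -scalerA.
exact: cvgZl_tmp.
Qed.

Lemma dist_seg_le {R : realType} {X : normedModType R} (w x y : X) (t : R) :
  0 <= t <= 1 -> dist_seg w x y <= `|w - ((1 - t) *: x + t *: y)|.
Proof.
by move=> t01; apply: ge_inf; [exists 0 => _ [? [_ ->]] | exists t].
Qed.

(** Contrapositive of the definition for unit vectors; the minimum with [1 / 2] makes [d] admissible
    in [exposing_function]. *)
Lemma uniformly_convex_sum {R : realType} {X : normedModType R} (a : R) :
  uniformly_convex X -> 0 < a ->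
  exists d : R, 0 < d <= 1 / 2 /\ forall u v : X, `|u| = 1 -> `|v| = 1 ->
    (1 - d) * 2 < `|u + v| -> `|u - v| < a.
Proof.
move=> uc a0; have [d [d0 h]] := uc a a0.
exists (Num.min d (1 / 2)); split.
  by rewrite lt_min d0 ge_min lexx orbT andbT; lra.
move=> u v u1 v1 uv; rewrite ltNge; apply/negP => auv.
have := h u v; rewrite u1 v1 lexx => /(_ isT isT auv).
rewrite normrZ ger0_norm ?invr_ge0//.
have : Num.min d (1 / 2) <= d by rewrite ge_min lexx.
by move: uv; lra.
Qed.

(** * The iteration and its constants *)

Theorem theorem4p1 (R : realType) (X Y : completeNormedModType R) :
  uniformly_convex X -> BPBp_compact_free X Y ->
  forall e : R, 0 < e -> exists eta : R, 0 < eta /\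
    forall rho : X -> X -> R, (forall x y : X, x <> y -> 0 < rho x y) ->
    forall (f : X -> Y) (x y : X),
      Lip0K f -> lipnorm f = 1 -> x <> y ->
      `|f x - f y| / `|x - y| > 1 - eta ->
      exists (g : X -> Y) (z : Y) (u xb : X),
        Lip0K g /\ lipnorm g = 1 /\ `|z| = 1 /\ `|u| = 1 /\
        lda_attains g xb u z /\
        lipnorm (fun t => g t - f t) < e /\
        `|u - (`|x - y|)^-1 *: (x - y)| < e /\
        dist_seg xb x y < e * rho x y.
Proof.
move=> uc _ e e0.
(* The perturbations sum to [2 * c] and normalization costs another [2 * c], so [e / 8] leaves room;
   the bound 1 keeps every [eta n] at most 1. *)
pose c : R := Num.min (e / 8) 1.
have c0 : 0 < c by rewrite lt_min ltr01 divr_gt0.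
have c1 : c <= 1 by rewrite ge_min lexx orbT.
have ce : c <= e / 8 by rewrite ge_min lexx.
have p2 n : 0 < 2 ^- n :> R by rewrite invr_gt0 exprn_gt0.
have p21 n : 2 ^- n <= 1 :> R by rewrite invf_le1 ?exprn_gt0// exprn_ege1// ler1n.
have a0 n : 0 < e / 4 * 2 ^- n by rewrite mulr_gt0// divr_gt0.
(* The tolerated turns [e / 4 * 2 ^- n] of the direction sum to [e / 2]. *)
have /choice[d dP] := fun n => uniformly_convex_sum _ uc (a0 n).
pose m n := c * 2 ^- n * d n / 2.
have m0 n : 0 < m n.
  by have [/andP[d0 _] _] := dP n; rewrite /m divr_gt0// !mulr_gt0.
have mc n : m n <= c * 2 ^- n.
  have [/andP[d0 d1] _] := dP n; have := mulr_gt0 c0 (p2 n).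
  by rewrite /m; nra.
(* [eta n] is the accuracy entering step [n] and the one demanded of step [n - 1]; the minimum gives
   [eta n + eta n.+1 <= 2 * m n]. For [n = 0] the predecessor is 0 and [eta 0] is [m 0], fixed
   before [rho] and [f]. *)
pose eta n := Num.min (m n) (m n.-1).
have eta0 n : 0 < eta n by rewrite lt_min !m0.
have etam n : eta n <= m n by rewrite ge_min lexx.
have etaS n : eta n.+1 <= m n by rewrite ge_min/= lexx orbT.
exists (eta 0%N); split => // rho rho0 f x y fK f1 xy fxy.
have xy0 : 0 < `|x - y| by rewrite normr_gt0 subr_eq0; exact/eqP.
(* [rho] enters through the length of the initial pair: the limit point is within twice that length
   of [p0], which lies on the segment. *)
have er0 : 0 < e * rho x y / 4 by rewrite divr_gt0// mulr_gt0// rho0.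
have [p0 [q0 [pq0 [s0 [_ [dir0 [/(_ (1 - eta 0%N)) sl0 [t t01 p0E]]]]]]]] :=
  short_pair f x y _ xy er0.
pose state : Type := ((X -> Y) * (X * X))%type.
pose inv n (s : state) := [/\ Lip0K s.1, 1 <= lipnorm s.1, s.2.1 <> s.2.2 &
  (lipnorm s.1 - eta n) * `|s.2.1 - s.2.2| < `|s.1 s.2.1 - s.1 s.2.2|].
pose rel n (s s' : state) := [/\ `|s'.2.1 - s.2.1| <= `|s.2.1 - s.2.2|,
  `|s'.2.1 - s'.2.2| <= `|s.2.1 - s.2.2| / 2,
  `| `|s'.2.1 - s'.2.2|^-1 *: (s'.2.1 - s'.2.2) -
     `|s.2.1 - s.2.2|^-1 *: (s.2.1 - s.2.2)| <= e / 4 * 2 ^- n &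
  forall v w, `|(s'.1 v - s.1 v) - (s'.1 w - s.1 w)| <= c * 2 ^- n * `|v - w|].
(* [next] is total: where the invariant fails, the state itself serves as a default value. *)
have /choice[next nextP] : forall ns : nat * state, exists s' : state,
    inv ns.1 ns.2 -> inv ns.1.+1 s' /\ rel ns.1 ns.2 s'.
  move=> [n [g [p q]]] /=.
  have [|ninv] := pselect (inv n (g, (p, q))); last by exists (g, (p, q)).
  move=> [/= gK g1 pq gpq]; have [d01 ucd] := dP n.
  have eta1 : 0 < eta n <= 1.
    rewrite eta0/=; apply: le_trans (etam n) _; apply: le_trans (mc n) _.
    by rewrite mulr_ile1// ltW.
  have etac : eta n + eta n.+1 <= c * 2 ^- n * d n.
    by have := etam n; have := etaS n; rewrite /m; lra.
  have [g' [p' [q' [[g'K gg' pq' g'pq] [pp qq uu dg]]]]] :=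
    step _ _ _ _ _ g p q d01 ucd (mulr_gt0 c0 (p2 n)) eta1 (eta0 n.+1) etac gK g1 pq gpq.
  exists (g', (p', q')) => _; split; split => //=.
    exact: le_trans gg'.
  exact: ltW.
pose st : nat -> state := fix st n :=
  if n is k.+1 then next (k, st k) else (f, (p0, q0)).
have st_inv n : inv n (st n).
  elim: n => [|n IH]; last by have [] := nextP (n, st n) IH.
  by split => //=; rewrite f1//; apply: sl0; rewrite -ltr_pdivlMr.
have st_rel n : rel n (st n) (st n.+1) by have [] := nextP (n, st n) (st_inv n).
have [||||||||G [v [xb [z [[GK G1 v1 GA] [Gf vu xbp]]]]]] :=
  limit_attains (fun n => (st n).1) (fun n => (st n).2.1) (fun n => (st n).2.2) (e / 4) c.
- by move=> n; have [] := st_inv n.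
- by move=> n; have [] := st_inv n.
- by move=> n; have [] := st_inv n.
- move=> n; have [_ _ _ h] := st_inv n; apply: le_lt_trans h.
  by rewrite ler_wpM2r// lerB// (le_trans (etam n)).
- by move=> n; have [] := st_rel n.
- by move=> n; have [] := st_rel n.
- by move=> n; have [] := st_rel n.
- by move=> n; have [] := st_rel n.
move: Gf vu xbp => /= Gf vu xbp.
have GL : Defs.lipschitz G by case: GK => -[].
have fL : Defs.lipschitz f by case: fK => -[].
set N := lipnorm G in G1 *; have N0 : 0 < N by lra.
have Ni0 : 0 < N^-1 by rewrite invr_gt0.
have GN : lipnorm (fun w => N^-1 *: G w) = 1.
  by rewrite (lipnormZ _ _ x y)// mulVf// gt_eqF.
have N2 : N <= 1 + 2 * c by have := lipnorm_add_le f G (2 * c) x y xy fL Gf; rewrite f1.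
have [zN _] := GA.
exists (fun w => N^-1 *: G w), (N^-1 *: z), v, xb.
split; first exact: Lip0KZ.
split; first exact: GN.
split; first by rewrite normrZ zN gtr0_norm// mulVf// gt_eqF.
split; first exact: v1.
split; first exact: lda_attainsZ.
split.
  (* One [2 * c] bounds [G - f]; the other bounds the effect of normalization,
     [(1 - N^-1) * N = N - 1]. *)
  apply: (@le_lt_trans _ _ (2 * c + 2 * c)); last by lra.
  apply: (lipnorm_le x y xy) => s w.
  have -> : N^-1 *: G s - f s - (N^-1 *: G w - f w) =
      (N^-1 - 1) *: (G s - G w) + ((G s - f s) - (G w - f w)).
    rewrite scalerBl scale1r scalerBr (subrACA (G s)) addrA subrK.
    by rewrite subrACA.
  apply: le_trans (ler_normD _ _) _; rewrite mulrDl lerD//.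
  rewrite normrZ ler0_norm; last by rewrite subr_le0 invf_le1.
  have := lipnorm_ge s w GL; rewrite -/N => h.
  have h2 : - (N^-1 - 1) * `|G s - G w| <= - (N^-1 - 1) * (N * `|s - w|).
    by rewrite ler_wpM2l// oppr_ge0 subr_le0 invf_le1.
  apply: le_trans h2 _; rewrite mulrA ler_wpM2r//.
  by rewrite mulNr mulrBl mulVf ?gt_eqF//; lra.
split; first by rewrite -dir0; lra.
apply: le_lt_trans (dist_seg_le xb x y t t01) _.
by rewrite -p0E; lra.
Qed.
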